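(* Let $1<p<\infty$. Let $A\in\Sigma$ be a measurable set and assume that $\mathbf{1}_A\in\widehat{X}_\omega$. Then exactly one of the following alternatives holds: (i) $A=\varnothing$ modulo null sets; (ii) $A=\Omega$ modulo null sets; (iii) there exist a unique index $n_0\in\mathbb{N}$ and a unique non-trivial subset $B\subseteq\Omega_{n_0}$ (i.e. $B\neq\varnothing$ and $B\neq\Omega_{n_0}$) such that $\mathbf{1}_A=J_{n_0}\mathbf{1}_B$ almost everywhere. Equivalently, every non-trivial indicator belonging to $\widehat{X}_\omega$ depends on a unique exterior coordinate.
   Context: All function spaces are real, $1<p<\infty$ is fixed, and $\mathbb{N}=\{1,2,\dots\}$. For $n\in\mathbb{N}$, $\Omega_n=\{0,1\}^n$ carries the uniform probability measure $\mu_n$ (on its power set), and $H_n=\{f\in L^p(\Omega_n,\mu_n):\int_{\Omega_n}f\,d\mu_n=0\}$. Let $(\Omega,\Sigma,\mu)=\prod_{n=1}^\infty(\Omega_n,\mathcal{P}(\Omega_n),\mu_n)$ be the product probability space, $\pi_n\colon\Omega\to\Omega_n$ the $n$-th (''exterior'') coordinate projection, and $J_n\colon L^p(\Omega_n,\mu_n)\to L^p(\Omega,\mu)$, $J_nf=f\circ\pi_n$. Let $X_\omega$ be the closure in $L^p(\Omega)$ of $\operatorname{span}\{J_n(H_n):n\in\mathbb{N}\}$. The unitalization of $X_\omega$ is $\widehat{X}_\omega=\mathbb{R}\mathbf{1}\oplus X_\omega\subseteq L^p(\Omega)$, where $\mathbf{1}$ is the constant function one. *)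

(* Defs.v *)
From HB Require Import structures.
From mathcomp Require Import all_boot all_order all_algebra finmap.
From mathcomp Require Import all_classical all_reals all_analysis.

Set Implicit Arguments.
Unset Strict Implicit.
Unset Printing Implicit Defensive.

Import Order.TTheory GRing.Theory Num.Theory.
Import numFieldNormedType.Exports.

Local Open Scope classical_set_scope.
Local Open Scope ring_scope.

Definition cube (n : nat) : Type := {ffun 'I_n -> bool}.

HB.instance Definition _ (n : nat) := Finite.on (cube n).
HB.instance Definition _ (n : nat) := isPointed.Build (cube n) [ffun=> false].
HB.instance Definition _ (n : nat) :=
  @isMeasurable.Build default_measure_display (cube n) discrete_measurable
    discrete_measurable0 discrete_measurableC discrete_measurableU.

Definition cube_unif (R : realType) (n : nat) : set (cube n) -> \bar R :=
  mscale ((2 ^+ n)^-1 : R)%:nng (@counting (cube n) R).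

HB.instance Definition _ (R : realType) (n : nat) :=
  Measure.on (@cube_unif R n).

Lemma cube_unif_setT (R : realType) (n : nat) :
  @cube_unif R n [set: cube n] = 1%E.
Proof.
rewrite /cube_unif /mscale /= /counting asboolT; last exact: finite_finset.
have -> : fset_set [set: cube n] = [fset x in enum {: cube n}]%fset.
  apply/fsetP => x; rewrite in_fset_set; last exact: finite_finset.
  by rewrite inE mem_enum in_setT inE.
rewrite card_imfset//= undup_id ?enum_uniq// -cardE card_ffun card_bool card_ord.
by rewrite -EFinM natrX mulVf// expf_neq0// pnatr_eq0.
Qed.

HB.instance Definition _ (R : realType) (n : nat) :=
  Measure_isProbability.Build _ _ _ (@cube_unif R n) (@cube_unif_setT R n).

(* [nat] starts at 0, so the factor of index [k] is {0,1}^(k+1). *)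
Definition cube_seq : Type := forall k : nat, cube k.+1.

HB.instance Definition _ := Pointed.on cube_seq.

Definition coord (k : nat) (w : cube_seq) : cube k.+1 := w k.

Definition cube_seq_gen : set (set cube_seq) :=
  \bigcup_k g_sigma_algebra_preimage (coord k).

Definition Omega : Type := g_sigma_algebraType cube_seq_gen.

HB.instance Definition _ := Measurable.on Omega.

(* This determines [mu] among probabilities on [Omega]: the finite rectangles
   generate the sigma-algebra and are stable under finite intersections. *)
Definition is_product_measure (R : realType) (mu : set Omega -> \bar R) : Prop :=
  forall (N : nat) (B : forall k : nat, set (cube k.+1)),
    mu (\bigcap_(k < N) coord k @^-1` B k) =
    (\prod_(k < N) @cube_unif R k.+1 (B k))%E.

Definition J (R : realType) (k : nat) (f : cube k.+1 -> R) : Omega -> R :=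
  fun w => f (coord k w).

Definition mean0 (R : realType) (p : R) (n : nat) : set (cube n -> R) :=
  [set f | f \in Lfun (@cube_unif R n) p%:E
           /\ (\int[@cube_unif R n]_x (f x)%:E = 0)%E].

Definition linspan (R : realType) (T : Type) (S : set (T -> R)) : set (T -> R) :=
  [set f | exists (m : nat) (a : 'I_m -> R) (g : 'I_m -> T -> R),
     (forall i, S (g i)) /\ f = \sum_(i < m) a i *: g i].

(* Elements of L^p are represented by functions, not by classes. *)
Definition Lclosure d (T : measurableType d) (R : realType)
    (mu : {measure set T -> \bar R}) (p : R) (S : set (T -> R)) :
    set (T -> R) :=
  [set f | f \in Lfun mu p%:E /\
     forall e : R, 0 < e ->
       exists2 g, S g & ('N[mu]_(p%:E)[EFin \o (f \- g)%R] < e%:E)%E].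

Definition Xomega (R : realType) (mu : {measure set Omega -> \bar R}) (p : R) :
    set (Omega -> R) :=
  Lclosure mu p (linspan (\bigcup_k (@J R k @` @mean0 R p k.+1))).

Definition Xhat (R : realType) (mu : {measure set Omega -> \bar R}) (p : R) :
    set (Omega -> R) :=
  [set f | exists (c : R), exists2 g, Xomega mu p g & f = cst c \+ g %[ae mu]].

Definition eq_mod_null d (T : measurableType d) (R : realType)
    (mu : {measure set T -> \bar R}) (A B : set T) : Prop :=
  mu.-negligible ((A `\` B) `|` (B `\` A)).

Definition is_coord_indicator (R : realType)
    (mu : {measure set Omega -> \bar R}) (A : set Omega)
    (k : nat) (B : set (cube k.+1)) : Prop :=
  [/\ B != set0, B != setT & (\1_A : Omega -> R) = J (\1_B) %[ae mu]].

Definition depends_only_on_coord (R : realType)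
    (mu : {measure set Omega -> \bar R}) (f : Omega -> R) (k : nat) : Prop :=
  exists g : cube k.+1 -> R, f = J g %[ae mu].

Definition exactly_one3 (P Q S : Prop) : Prop :=
  [\/ [/\ P, ~ Q & ~ S], [/\ ~ P, Q & ~ S] | [/\ ~ P, ~ Q & S]].

(* Main.v *)
Require Import Defs.
From mathcomp Require Import all_boot all_order all_algebra finmap.
From mathcomp Require Import all_classical all_reals all_analysis.
From mathcomp Require Import measurable_realfun ring lra.

(** View Omega as the compact group of sequences of bit vectors under
    coordinatewise addition modulo 2. Translations preserve the product
    measure, since they permute each factor and a measure on Omega is
    determined by its values on finite rectangles.

    A finite sum of functions of single coordinates has vanishing mixed
    differences: h w + h (a + b + w) = h (a + w) + h (b + w) as soon as a and
    b have disjoint supports. By Markov's inequality an indicator lying in the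
    unitalization is, off a set of arbitrarily small measure, within 1/4 of
    such a sum plus a constant. The mixed difference of the indicator is
    integer-valued, so it vanishes almost everywhere (second_difference).

    Fix a coordinate i, and let a be supported at i and b off i. The vanishing
    of the mixed difference of two-valued functions says that almost everywhere
    at least one of the translations by a and by b leaves membership in A
    unchanged; moreover the set E where a changes it is invariant under b, and
    the set F where b changes it is invariant under a. A zero-one law
    (zero_one_off, an application of Tonelli to the action of the translations
    off i) shows that E has full or zero measure inside each cylinder fixing
    the coordinate i. If E is not null, it fills one of these cylinders; F is
    then null there, and null everywhere by invariance. Hence, for every i, A
    is invariant either under all translations at i or under all translations
    off i (dichotomy).

    In the second case the zero-one law, applied to A itself, makes A a
    union of cylinders fixing the coordinate i, up to null sets. If the first
    case holds for every i, then A is invariant under translations of finite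
    support, and by approximation under all translations, so the zero-one law
    applies again, with any coordinate in the role of i.

    Uniqueness holds because each cylinder fixing finitely many coordinates has
    positive measure: functions of two distinct coordinates that agree almost
    everywhere are constant (ae_coord_neq). *)

Set Implicit Arguments.
Unset Strict Implicit.
Unset Printing Implicit Defensive.

Import Order.TTheory GRing.Theory Num.Theory.

Local Open Scope classical_set_scope.
Local Open Scope ring_scope.

Local Notation coord := Defs.coord.

(** * Translations of the group of bit sequences *)

Definition cxor n (x y : cube n) : cube n := [ffun i => x i (+) y i].
Definition czero n : cube n := [ffun=> false].
Definition shift (a w : Omega) : Omega := fun k => cxor (a k) (w k).

(** [only i] and [away i] are the projections that split the group into the
    factor of index [i] and the product of the other factors. *)
Definition only (i : nat) (a : Omega) : Omega :=
  fun k => if k == i then a k else czero k.+1.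
Definition away (i : nat) (a : Omega) : Omega :=
  fun k => if k == i then czero k.+1 else a k.

Lemma cxorA n : associative (@cxor n).
Proof. by move=> x y z; apply/ffunP => i; rewrite !ffunE addbA. Qed.
Lemma cxorC n : commutative (@cxor n).
Proof. by move=> x y; apply/ffunP => i; rewrite !ffunE addbC. Qed.
Lemma cxor0l n : left_id (czero n) (@cxor n).
Proof. by move=> x; apply/ffunP => i; rewrite !ffunE. Qed.
Lemma cxorK n (x : cube n) : cancel (cxor x) (cxor x).
Proof. by move=> y; apply/ffunP => i; rewrite !ffunE addbA addbb addFb. Qed.

Lemma shiftA : associative shift.
Proof.
by move=> a b c; apply/functional_extensionality_dep => k; exact: cxorA.
Qed.
Lemma shiftC : commutative shift.
Proof.
by move=> a b; apply/functional_extensionality_dep => k; exact: cxorC.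
Qed.
Lemma shift0 : shift (fun k => czero k.+1) = id.
Proof.
by apply/funext => w; apply/functional_extensionality_dep => k; exact: cxor0l.
Qed.

Lemma shift_only_away i a : shift (only i a) (away i a) = a.
Proof.
apply/functional_extensionality_dep => k; rewrite /shift /only /away.
by case: ifP => _; rewrite ?cxor0l // cxorC cxor0l.
Qed.

Lemma exists_coord i (x : cube i.+1) : exists c : Omega, c i = x.
Proof.
exists (fun k => [ffun j : 'I_k.+1 => x (inord j)]).
by apply/ffunP => j; rewrite ffunE inord_val.
Qed.

(** * Measurability *)

Lemma measurable_coord k :
  measurable_fun [set: Omega] (coord k : Omega -> cube k.+1).
Proof.
move=> _ B _; rewrite setTI; apply: sub_sigma_algebra.
by exists k => //; exists B => //; rewrite setTI.
Qed.

Lemma measurable_preimage_Omega d (T : measurableType d) (F : T -> Omega)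
    (E : set Omega) :
  measurable_fun setT F -> measurable E -> measurable (F @^-1` E).
Proof. by move=> mF mE; rewrite -[X in measurable X]setTI; exact: mF. Qed.

Lemma measurable_coord_preimage k (B : set (cube k.+1)) :
  measurable (coord k @^-1` B : set Omega).
Proof. by rewrite -[X in measurable X]setTI; apply: measurable_coord. Qed.

Lemma measurable_to_Omega d (T : measurableType d) (F : T -> Omega) :
  (forall k B, measurable ((fun t => coord k (F t)) @^-1` B)) ->
  measurable_fun setT F.
Proof.
move=> mF; apply: (@measurability _ _ T Omega _ _ cube_seq_gen) => //.
move=> _ [_ [k _ [B _ <-]] <-]; rewrite !setTI; exact: mF.
Qed.

(** Joint measurability in both summands is what makes Tonelli's theorem
    available for the action of the group on itself. *)
Lemma measurable_shift2 d (T : measurableType d) (F G : T -> Omega) :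
  measurable_fun setT F -> measurable_fun setT G ->
  measurable_fun setT (fun t => shift (F t) (G t)).
Proof.
move=> mF mG; apply: measurable_to_Omega => k B.
have mcoord (H : T -> Omega) (C : set (cube k.+1)) : measurable_fun setT H ->
    measurable ((coord k \o H : T -> cube k.+1) @^-1` C).
  move=> mH; rewrite comp_preimage; apply: measurable_preimage_Omega mH _.
  exact: measurable_coord_preimage.
(* Condition on the finitely many values of the coordinate of [F t]. *)
rewrite (_ : _ @^-1` _ = \bigcup_(x in [set: cube k.+1])
    ((coord k \o F) @^-1` [set x] `&` (coord k \o G) @^-1` (cxor x @^-1` B))).
  apply: fin_bigcup_measurable => [|x _]; first exact: finite_finset.
  by apply: measurableI; exact: mcoord.
apply/seteqP; split=> [t Bt|t [x _ [<- //]]].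
by exists (coord k (F t)).
Qed.

Lemma measurable_shift a : measurable_fun setT (shift a).
Proof.
apply: (@measurable_shift2 _ Omega (fun=> a) idfun).
  exact: measurable_cst.
exact: measurable_id.
Qed.

Lemma measurable_away i : measurable_fun setT (away i).
Proof.
apply: measurable_to_Omega => k B; rewrite /away /coord /=.
case: (k == i); last exact: measurable_coord_preimage.
have [Bc|nBc] := pselect (B (czero k.+1)).
  by rewrite (_ : _ @^-1` _ = setT) //; apply/seteqP; split.
by rewrite (_ : _ @^-1` _ = set0) //; apply/seteqP; split.
Qed.

(** * Translation invariance of the product measure *)

Lemma cube_unifE (R : realType) n (B : set (cube n)) :
  @cube_unif R n B = (((2 ^+ n)^-1 : R) * #|` fset_set B|%:R)%:E.
Proof.
by rewrite /cube_unif /mscale /= /counting asboolT //; exact: finite_finset.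
Qed.

Lemma cube_unif_cxor (R : realType) n (x : cube n) (B : set (cube n)) :
  @cube_unif R n (cxor x @^-1` B) = @cube_unif R n B.
Proof.
have -> : cxor x @^-1` B = cxor x @` B.
  apply/seteqP; split=> [y By|_ [y By <-]]; last by rewrite /preimage /= cxorK.
  by exists (cxor x y) => //; rewrite cxorK.
rewrite !cube_unifE fset_set_image; last exact: finite_finset.
by rewrite card_imfset //; exact: can_inj (cxorK x).
Qed.

Lemma cube_unif1_gt0 (R : realType) n (x : cube n) :
  (0 < @cube_unif R n [set x])%E.
Proof.
rewrite cube_unifE fset_set1 cardfs1 mulr1 lte_fin invr_gt0 exprn_gt0 //.
Qed.

Definition rect (N : nat) (B : forall k, set (cube k.+1)) : set Omega :=
  \bigcap_(k < N) coord k @^-1` B k.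

Lemma measurable_rect N B : measurable (rect N B).
Proof.
by apply: bigcap_measurableType => k _; exact: measurable_coord_preimage.
Qed.

Lemma measurable_rectE :
  @measurable _ Omega = <<s [set C | exists N B, C = rect N B] >>.
Proof.
apply/seteqP; split; apply: smallest_sub.
- exact: smallest_sigma_algebra.
- move=> _ [k _ [B _ <-]]; rewrite setTI; apply: sub_sigma_algebra.
  (* A dependent family that is [B] at index [k] and everything elsewhere. *)
  exists k.+1, (fun j => [set x | j = k ->
    forall w : Omega, w j = x -> B (w k)]).
  apply/seteqP; split => [w Bw j /= _ jk v|w /(_ k (ltnSn k))/=].
    by subst j; rewrite /coord => ->.
  by move=> /(_ erefl w erefl).
- exact: sigma_algebra_measurable.
- move=> _ [N [B ->]]; exact: measurable_rect.
Qed.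

Lemma setI_closed_rect : setI_closed [set C | exists N B, C = rect N B].
Proof.
move=> _ _ [N [B ->]] [M [C ->]]; exists (maxn N M),
  (fun k => [set x | (k < N)%N -> B k x] `&` [set x | (k < M)%N -> C k x]).
apply/seteqP; split => [w [wB wC] k _|w wBC].
  by split=> /= kN; [exact: wB|exact: wC].
split=> k /= kN; have [] := wBC k; rewrite /= ?leq_max ?kN ?orbT //.
  by move=> + _; apply.
by move=> _; apply.
Qed.

Section product_measure.
Variables (R : realType) (mu : probability Omega R).
Hypothesis hmu : is_product_measure mu.

(** Translating a finite rectangle permutes each factor, so the translated
    measure has the same values on finite rectangles, which form a generating
    pi-system. *)
Lemma product_measure_shift a (A : set Omega) :
  measurable A -> mu (shift a @^-1` A) = mu A.
Proof.
move=> mA.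
pose nu : {measure set Omega -> \bar R} := pushforward mu (shift a).
change (nu (measurable_shift a) A = mu A).
refine (@measure_unique _ R Omega _ (fun=> rect 0 (fun=> setT)) measurable_rectE
  setI_closed_rect _ _ (nu (measurable_shift a)) mu _ _ A mA).
- by move=> _; exists 0%N, (fun=> setT).
- by apply/seteqP; split => // w _; exists 0%N.
- move=> _ [N [B ->]]; rewrite /nu /pushforward /rect.
  transitivity (mu (rect N (fun k => cxor (a k) @^-1` B k))); first by [].
  apply: etrans (esym (hmu N B)); rewrite /rect hmu.
  by apply: eq_bigr => k _; exact: cube_unif_cxor.
- move=> _; rewrite (_ : rect 0 _ = setT); last exact/seteqP.
  by rewrite /nu /= /pushforward preimage_setT probability_setT ltry.
Qed.

Lemma ae_shift a (Q : Omega -> Prop) :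
  {ae mu, forall w, Q w} -> {ae mu, forall w, Q (shift a w)}.
Proof.
move=> [N [mN N0 QN]]; exists (shift a @^-1` N); split.
- by rewrite -[X in measurable X]setTI; apply: measurable_shift.
- by rewrite product_measure_shift.
- by move=> w /= nQ; exact: (QN (shift a w)).
Qed.

(** Cylinders fixing finitely many coordinates have positive measure, so a
    property true almost everywhere holds at a point with any prescribed
    first coordinates. *)
Lemma ae_meets_cylinder (Q : Omega -> Prop) (N : nat) (c : Omega) :
  {ae mu, forall w, Q w} -> exists2 w, Q w & forall k, (k < N)%N -> w k = c k.
Proof.
move=> aeQ; apply: contrapT => nQ.
suff : mu (rect N (fun k => [set c k])) = 0.
  rewrite /rect hmu; apply/eqP; rewrite gt_eqF //.
  elim/big_rec: _ => [|k x _ x0]; first exact: lte01.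
  by rewrite mule_gt0 // cube_unif1_gt0.
apply: measure_negligible; first exact: measurable_rect.
apply: negligibleS aeQ => w wc /= Qw.
by apply: nQ; exists w => // k kN; exact: wc.
Qed.

End product_measure.

(** * A zero-one law for invariance off one coordinate *)

Section zero_one.
Variables (R : realType) (mu : probability Omega R).
Hypothesis hmu : is_product_measure mu.

(** Let C be the part of E in the cylinder, and S the set of pairs (a, w) with
    w in C and the translate of w by the part of a off i outside E. Invariance
    makes every section of S at a fixed a null. At a fixed w in C, the translate
    of w is the sum of a and w with its coordinate i reset to that of c, so by
    translation invariance the section at w has the measure of the set K of
    points that leave E after this reset. Tonelli gives mu C * mu K = 0. *)
Lemma zero_one_off i (E : set Omega) (c : Omega) : measurable E ->
  (forall b, {ae mu, forall w, E w -> E (shift (away i b) w)}) ->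
  {ae mu, forall w, w i = c i -> E w} \/ {ae mu, forall w, w i = c i -> ~ E w}.
Proof.
move=> mE inv.
pose put u := shift (only i c) (away i u).
pose C := E `&` coord i @^-1` [set c i].
have putE (a w : Omega) : w i = c i -> shift (away i a) w = put (shift w a).
  move=> wi; apply/functional_extensionality_dep => k.
  rewrite /put /shift /only /away; case: eqP => [->|_].
    by rewrite wi cxor0l cxorC cxor0l.
  by rewrite cxor0l cxorC.
have put_id (w : Omega) : w i = c i -> put w = w.
  move=> wi; rewrite -[RHS](shift_only_away i) /put; congr shift.
  apply/functional_extensionality_dep => k; rewrite /only.
  by case: eqP => // ->.
have mput : measurable_fun setT put.
  apply: measurable_shift2; [exact: measurable_cst|exact: measurable_away].
have mC : measurable C.
  by apply: measurableI => //; exact: measurable_coord_preimage.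
pose K := put @^-1` (~` E).
have mK : measurable K.
  by apply: measurable_preimage_Omega => //; exact: measurableC.
pose S : set (Omega * Omega) :=
  [set z | C z.2 /\ ~ E (shift (away i z.1) z.2)].
have mS : measurable S.
  have mact : measurable_fun setT
      (fun z : Omega * Omega => shift (away i z.1) z.2).
    apply: measurable_shift2; last exact: measurable_snd.
    exact: (measurableT_comp (measurable_away i) measurable_fst).
  have -> : S = snd @^-1` C `&`
      (fun z => shift (away i z.1) z.2) @^-1` (~` E) by [].
  apply: measurableI; first exact: (measurable_preimage_Omega measurable_snd).
  by apply: (measurable_preimage_Omega mact); exact: measurableC.
have : (\int[mu]_a mu (xsection S a) = \int[mu]_w mu (ysection S w))%E.
  have := indic_fubini_tonelli mu mu mS.
  by rewrite indic_fubini_tonelli_FE // indic_fubini_tonelli_GE.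
rewrite integral0_eq; last first.
  move=> a _; apply: measure_negligible; first exact: measurable_xsection.
  apply: negligibleS (inv a) => w.
  by rewrite /xsection /= inE => -[[Ew _] nE] /(_ Ew); exact: nE.
rewrite (eq_integral (fun w => (\1_C w)%:E * mu K)%E); last first.
  move=> w _; rewrite indicE; case: (boolP (w \in C)) => [|/negP wC] /=.
    rewrite inE => -[Ew wi]; rewrite mul1e -(product_measure_shift hmu w mK).
    congr (mu _); apply/seteqP.
    split=> a; rewrite /ysection /= inE /S /K /preimage /=.
      by move=> [_]; rewrite putE.
    by rewrite -putE.
  rewrite mul0e (_ : ysection S w = set0) ?measure0 //.
  apply/seteqP; split=> // a; rewrite /ysection /= inE => -[Cw _].
  by apply: wC; rewrite inE.
rewrite ge0_integralZr ?integral_indic ?setIT //; last first.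
  by apply/measurable_EFinP; exact: measurable_indic.
move/esym/eqP; rewrite mule_eq0 => /orP[] /eqP m0; [right|left].
  exists C; split => // w /= nw.
  by split; [apply: contrapT => nE|apply: contrapT => nC]; apply: nw.
exists K; split => // w /= nw Ew; apply: nw => wi.
by rewrite -(put_id _ wi).
Qed.

End zero_one.

(** * Approximation in measure by finite sums of functions of one coordinate *)

(** The exceptional sets for e = 1/(n+1) have a null intersection. *)
Lemma ae_of_small_exceptions d (T : measurableType d) (R : realType)
    (mu : {measure set T -> \bar R}) (Q : T -> Prop) :
  (forall e : R, 0 < e -> exists M : set T,
     [/\ measurable M, (mu M < e%:E)%E & forall w, ~ M w -> Q w]) ->
  {ae mu, forall w, Q w}.
Proof.
move=> small.
have /choice[M hM] (n : nat) : exists M : set T,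
    [/\ measurable M, (mu M < (n.+1%:R^-1 : R)%:E)%E & forall w, ~ M w -> Q w].
  by apply: small; rewrite invr_gt0.
have mI : measurable (\bigcap_n M n).
  by apply: bigcapT_measurable => n; case: (hM n).
exists (\bigcap_n M n); split => //; last first.
  move=> w nQ n _; apply: contrapT => nM; apply: nQ.
  by case: (hM n) => _ _; exact.
apply/eqP; rewrite -measure_le0; apply/lee_addgt0Pr => e e0; rewrite add0e.
have [n ne] : exists n : nat, n.+1%:R^-1 < e.
  have [n _ /(_ n (leqnn n))] := near_infty_natSinv_lt (PosNum e0).
  by exists n.
apply: (@le_trans _ _ (mu (M n))).
  by apply: le_measure; rewrite ?inE //; [case: (hM n)|move=> w; exact].
have [_ Mn _] := hM n.
by apply: ltW; apply: lt_trans Mn _; rewrite lte_fin.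
Qed.

Lemma measureU_lt d (T : measurableType d) (R : realType)
    (mu : {measure set T -> \bar R}) (M N : set T) (a b : R) :
  measurable M -> measurable N -> (mu M < a%:E)%E -> (mu N < b%:E)%E ->
  (mu (M `|` N) < (a + b)%:E)%E.
Proof.
move=> mM mN Ma Nb; apply: le_lt_trans (measureU2 _ mM mN) _.
by rewrite EFinD lteD.
Qed.

Definition disjoint_supports (a b : Omega) : Prop :=
  forall k, a k = czero k.+1 \/ b k = czero k.+1.

Section approximation.
Variable R : realType.

(** An intrinsic form of being a finite sum of functions of single coordinates:
    it keeps exactly the two consequences used, and is visibly stable under
    linear combinations. *)
Definition finitary_additive (h : Omega -> R) : Prop :=
  (exists N : nat, forall w w' : Omega,
     (forall k, (k < N)%N -> w k = w' k) -> h w = h w') /\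
  (forall a b w, disjoint_supports a b ->
     h w + h (shift a (shift b w)) = h (shift a w) + h (shift b w)).

Lemma finitary_additive_cst (c : R) : finitary_additive (cst c).
Proof. by split=> //; exists 0%N. Qed.

Lemma finitary_additive_add (h1 h2 : Omega -> R) :
  finitary_additive h1 -> finitary_additive h2 -> finitary_additive (h1 + h2).
Proof.
move=> [[N1 d1] s1] [[N2 d2] s2]; split.
  exists (maxn N1 N2) => w w' ww'.
  change (h1 w + h2 w = h1 w' + h2 w').
  by congr (_ + _); [apply: d1|apply: d2] => k kN;
    apply: ww'; rewrite leq_max kN ?orbT.
move=> a b w ab.
change (h1 w + h2 w + (h1 (shift a (shift b w)) + h2 (shift a (shift b w))) =
  h1 (shift a w) + h2 (shift a w) + (h1 (shift b w) + h2 (shift b w))).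
by rewrite addrACA s1 // s2 // addrACA.
Qed.

Lemma finitary_additive_scale (c : R) (h : Omega -> R) :
  finitary_additive h -> finitary_additive (c *: h).
Proof.
move=> [[N d] s]; split.
  by exists N => w w' ww'; change (c * h w = c * h w'); rewrite (d w w').
move=> a b w ab.
change (c * h w + c * h (shift a (shift b w)) =
  c * h (shift a w) + c * h (shift b w)).
by rewrite -!mulrDr s.
Qed.

Lemma finitary_additive_J k (u : cube k.+1 -> R) : finitary_additive (J u).
Proof.
split; first by exists k.+1 => w w' ww'; rewrite /J /coord ww'.
move=> a b w ab; rewrite /J /coord /shift.
by case: (ab k) => ->; rewrite !cxor0l 1?addrC.
Qed.

Lemma measurable_J k (u : cube k.+1 -> R) : measurable_fun setT (J u).
Proof.
by move=> _ B _; rewrite setTI; exact: (measurable_coord_preimage (u @^-1` B)).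
Qed.

Lemma linspan_J (mu : {measure set Omega -> \bar R}) p s :
  linspan (\bigcup_k (@J R k @` @mean0 R p k.+1)) s ->
  finitary_additive s /\ measurable_fun setT s.
Proof.
move=> [m [a [g [Sg ->]]]].
apply: (big_ind (fun s : Omega -> R =>
  finitary_additive s /\ measurable_fun setT s)).
- by split; [exact: finitary_additive_cst|exact: measurable_cst].
- move=> h1 h2 [a1 m1] [a2 m2]; split; first exact: finitary_additive_add.
  exact: measurable_funD.
- move=> i _; have [k _ [u _ <-]] := Sg i.
  split; first by apply/finitary_additive_scale/finitary_additive_J.
  by apply: measurable_funM; [exact: measurable_cst|exact: measurable_J].
Qed.

(** Markov's inequality, in the form fitted to an L^p bound. *)
Lemma Lnorm_markov d (T : measurableType d) (mu : {measure set T -> \bar R})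
    (p : R) (f : T -> R) (t e : R) : 0 < p -> 0 < t -> 0 < e ->
  measurable_fun setT f ->
  ('N[mu]_(p%:E)[EFin \o f] < ((t `^ p * e) `^ p^-1)%:E)%E ->
  (mu [set w | (t <= `|f w|)%R] < e%:E)%E.
Proof.
move=> p0 t0 e0 mf Nf.
have tp0 : 0 < t `^ p by rewrite powR_gt0.
have mEf : measurable_fun setT (EFin \o f) by exact/measurable_EFinP.
have mono : {in `[0%E, +oo[%classic &,
    {homo (fun x : \bar R => (x `^ p)%E) : x y / (x <= y)%E}}.
  move=> x y; rewrite !inE /= !in_itv /= => /andP[x1 _] /andP[y1 _].
  by apply: gt0_ler_poweR; rewrite ?ltW // in_itv /= ?x1 ?y1 leey.
have := le_integral_comp_abse mu measurableT (measurable_poweR p)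
  (fun r _ => poweR_ge0 r p) mono mEf t0.
rewrite setTI -poweR_Lnorm ?gt_eqF // => /le_lt_trans H.
(* Raise the bound on the norm to the power [p]. *)
have {}H : ((t `^ p)%:E * mu [set w | (t <= `|f w|)%R] < (t `^ p * e)%:E)%E.
  apply: H; rewrite -[X in (_ < X%:E)%E](powRr1 (mulr_ge0 (ltW tp0) (ltW e0))).
  rewrite -(mulVf (lt0r_neq0 p0)) powRrM.
  have := Lnorm_ge0 mu p%:E (EFin \o f).
  case: ('N[mu]_(p%:E)[EFin \o f])%E Nf => [r| |] //=.
  rewrite lee_fin !lte_fin => rlt r0; apply: gt0_ltr_powR => //.
  by rewrite nnegrE powR_ge0.
by move: H; rewrite EFinM lte_pmul2l // lte_fin.
Qed.

Variable mu : probability Omega R.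

(** Approximation in measure rather than in norm: it suffices to recognize
    an integer value, and it is transported by translations without integrals. *)
Definition approximable (f : Omega -> R) : Prop :=
  forall t e : R, 0 < t -> 0 < e ->
  exists h : Omega -> R, exists M : set Omega,
    [/\ finitary_additive h, measurable M, (mu M < e%:E)%E &
        forall w, ~ M w -> `|f w - h w| < t].

Lemma Xhat_approximable (p : R) (f : Omega -> R) :
  1 < p -> Xhat mu p f -> approximable f.
Proof.
move=> p1 [c [g [gL gapp] [N [mN N0 fN]]]] t e t0 e0.
have p0 : 0 < p := lt_trans ltr01 p1.
have [|s sspan sg] := gapp ((t `^ p * e) `^ p^-1).
  by rewrite powR_gt0 // mulr_gt0 // powR_gt0.
have [sadd ms] := linspan_J mu sspan.
have mgs : measurable_fun setT (g \- s).
  apply: measurable_funB => //.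
  by have := sub_Lfun_mfun gL; rewrite inE.
have := Lnorm_markov p0 t0 e0 mgs sg.
set M := [set w | _] => Me.
have mM : measurable M.
  rewrite -[M]setTI; apply: measurable_fun_le => //.
  exact: measurableT_comp.
exists (cst c + s), (N `|` M); split => //.
- by apply: finitary_additive_add => //; exact: finitary_additive_cst.
- exact: measurableU.
- apply: le_lt_trans Me; rewrite -[leRHS]add0e -N0; exact: measureU2.
move=> w; rewrite not_orE => -[nN /negP]; rewrite -ltNge => gs.
have -> : f w = c + g w.
  by apply: contrapT => fw; apply: nN; apply: fN => /= /(_ I).
by rewrite [X in _ - X](_ : _ = c + s w) // opprD addrACA subrr add0r.
Qed.

End approximation.

(** * Approximable indicators *)

Lemma ae_imply d (T : measurableType d) (R : realType)
    (mu : {measure set T -> \bar R}) (P Q : T -> Prop) :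
  (forall w, P w -> Q w) ->
  {ae mu, forall w, P w} -> {ae mu, forall w, Q w}.
Proof. by move=> PQ; apply: filterS. Qed.

Lemma ae_imply2 d (T : measurableType d) (R : realType)
    (mu : {measure set T -> \bar R}) (P Q S : T -> Prop) :
  (forall w, P w -> Q w -> S w) ->
  {ae mu, forall w, P w} -> {ae mu, forall w, Q w} -> {ae mu, forall w, S w}.
Proof. by move=> PQS; apply: filterS2. Qed.

Section indicator.
Variables (R : realType) (mu : probability Omega R).
Hypothesis hmu : is_product_measure mu.
Variable A : set Omega.
Hypothesis mA : measurable A.
Hypothesis approxA : approximable mu (\1_A).

(** Transfer from approximants to the indicator. The three translations may
    depend on the approximant, which lets finitely many coordinates stand for
    all of them. *)
Lemma ae_of_approximants (Q : Omega -> Prop) :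
  (forall h : Omega -> R, finitary_additive h -> exists a b c,
    {ae mu, forall w,
      (forall d, [\/ d = id, d = shift a, d = shift b | d = shift c] ->
        `|\1_A (d w) - h (d w)| < 4^-1) -> Q w}) ->
  {ae mu, forall w, Q w}.
Proof.
move=> hQ; apply: ae_of_small_exceptions => e e0.
have e4 : 0 < e / 4 by rewrite divr_gt0.
have [|h [M [hadd mM Me hM]]] := approxA (t := 4^-1) _ e4.
  by rewrite invr_gt0.
have [a [b [c [N [mN N0 NQ]]]]] := hQ h hadd.
have mS x : measurable (shift x @^-1` M).
  exact: (measurable_preimage_Omega (measurable_shift x)).
have addM x X r : measurable X /\ (mu X < r%:E)%E ->
    measurable (shift x @^-1` M `|` X) /\
    (mu (shift x @^-1` M `|` X) < (e / 4 + r)%:E)%E.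
  move=> [mX Xr]; split; first exact: measurableU.
  apply: (measureU_lt (mS x) mX _ Xr).
  by rewrite [ltLHS]product_measure_shift.
have [mU Ue] : measurable (N `|` M) /\ (mu (N `|` M) < (e / 4)%:E)%E.
  split; first exact: measurableU.
  by apply: le_lt_trans Me; rewrite -[leRHS]add0e -N0; exact: measureU2.
exists (shift a @^-1` M `|`
  (shift b @^-1` M `|` (shift c @^-1` M `|` (N `|` M)))).
have [mE Ee] := addM a _ _ (addM b _ _ (addM c _ _ (conj mU Ue))).
split=> //; first by apply: lt_le_trans Ee _; rewrite lee_fin; lra.
move=> w; rewrite !not_orE => -[Ma [Mb [Mc [nN M0]]]].
apply: contrapT => nQ; apply: nN; apply: NQ => /= hw; apply: nQ.
by apply: hw => d [] ->; apply: hM.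
Qed.

(** Four values within 1/4 of those of a function with zero mixed difference
    have a mixed difference smaller than 1, which is 0 for an indicator. *)
Lemma second_difference a b : disjoint_supports a b ->
  {ae mu, forall w, ((w \in A) + (shift a (shift b w) \in A) =
                     (shift a w \in A) + (shift b w \in A))%N}.
Proof.
move=> ab; apply: ae_of_approximants => h [_ /(_ a b) hab].
exists a, b, (shift a b); apply: aeW => w small.
have {}hab := hab w ab.
have := small id (Or41 _ _ _ erefl).
have := small _ (Or42 _ _ _ erefl).
have := small _ (Or43 _ _ _ erefl).
have := small _ (Or44 _ _ _ erefl).
rewrite !indicE -shiftA !ltr_norml.
move: (shift a (shift b w) \in A) (shift a w \in A) (shift b w \in A) (w \in A).
case; case; case; case => //= /andP[? ?] /andP[? ?] /andP[? ?] /andP[? ?];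
  exfalso; lra.
Qed.

Definition ae_invariant b := {ae mu, forall w, (shift b w \in A) = (w \in A)}.

Definition below N (b : Omega) : Omega :=
  fun k => if (k < N)%N then b k else czero k.+1.

(** An approximant depends on finitely many coordinates, hence does not
    distinguish the translation by [b] from that by a truncation of [b]. *)
Lemma invariant_below b :
  (forall N, ae_invariant (below N b)) -> ae_invariant b.
Proof.
move=> inv; apply: ae_of_approximants => h [[N hN] _].
exists b, (below N b), (below N b).
apply: ae_imply (inv N) => w <- small.
have := small _ (Or42 _ _ _ erefl).
have := small _ (Or43 _ _ _ erefl).
rewrite (hN (shift b w) (shift (below N b) w)); last first.
  by move=> k kN; rewrite /shift /below kN.
rewrite !indicE !ltr_norml.
move: (shift b w \in A) (shift (below N b) w \in A).
by case; case => //= /andP[? ?] /andP[? ?]; exfalso; lra.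
Qed.

Lemma invariant_all :
  (forall i b, ae_invariant (only i b)) -> forall b, ae_invariant b.
Proof.
move=> inv b; apply: invariant_below; elim=> [|N IH].
  by apply: aeW => w; congr (_ \in A); exact: (congr1 (@^~ w) shift0).
have E w : shift (below N.+1 b) w = shift (only N b) (shift (below N b) w).
  apply/functional_extensionality_dep => k.
  rewrite /shift /below /only ltnS leq_eqVlt; case: eqP => [->|_] /=.
    by rewrite ltnn cxor0l.
  by rewrite cxor0l.
have := ae_shift hmu (below N b) (inv N b).
apply: ae_imply2 IH => w; rewrite E => <- -> //.
Qed.

(** Membership in A is two-valued, so a vanishing mixed difference means that
    translations at i and off i cannot both change it at the same point. If
    some translation at i changes it on a set E that is not null, then E fills
    a cylinder fixing the coordinate i by the zero-one law; there translations
    off i change nothing, and moving the cylinder by translations at i carries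
    this to the whole space. *)
Lemma dichotomy i :
  (forall a, ae_invariant (only i a)) \/ (forall b, ae_invariant (away i b)).
Proof.
have sd a b : {ae mu, forall w,
    ((w \in A) + (shift (only i a) (shift (away i b) w) \in A) =
     (shift (only i a) w \in A) + (shift (away i b) w \in A))%N}.
  apply: second_difference => k; rewrite /only /away.
  by case: eqP; [right|left].
have [|/existsNP[a na]] := pselect (forall a, ae_invariant (only i a)).
  by left.
right=> b.
pose E := [set w | (shift (only i a) w \in A) != (w \in A)].
have mE : measurable E.
  have mSA := measurable_preimage_Omega (measurable_shift (only i a)) mA.
  rewrite (_ : E = (shift (only i a) @^-1` A `\` A) `|`
      (A `\` shift (only i a) @^-1` A)).
    by apply: measurableU; exact: measurableD.
  apply/seteqP; split=> w; rewrite /E /= /preimage /=.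
    case: (boolP (shift _ _ \in A)) => [|/negP]; rewrite inE;
    case: (boolP (w \in A)) => [|/negP]; rewrite inE //; by [left|right].
  by case=> -[p q]; rewrite (mem_set p) (memNset q).
have Einv d : {ae mu, forall w, E w -> E (shift (away i d) w)}.
  apply: ae_imply (sd a d) => w; rewrite /E /=.
  by do 4 (case: (_ \in A)).
have [c Ec] : exists c : Omega, {ae mu, forall w, w i = c i -> E w}.
  apply: contrapT => nEc; apply: na.
  have : {ae mu, forall w (x : cube i.+1), w i = x -> ~ E w}.
    apply: (filter_forall (ae_filter_ringOfSetsType mu)) => x.
    have [c <-] : exists c : Omega, c i = x by exact: exists_coord.
    have [Ec|//] := zero_one_off hmu c mE Einv.
    by exfalso; apply: nEc; exists c.
  move=> aex; apply: ae_imply aex => w.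
  by move=> /(_ _ erefl) /negP/negPn/eqP.
have Fc : {ae mu, forall w, w i = c i ->
    (shift (away i b) w \in A) = (w \in A)}.
  apply: ae_imply2 Ec (sd a b) => w Ew sdw wi; move: (Ew wi) sdw; rewrite /E /=.
  by do 4 (case: (_ \in A)).
have : {ae mu, forall w (x : cube i.+1), w i = x ->
    (shift (away i b) w \in A) = (w \in A)}.
  apply: (filter_forall (ae_filter_ringOfSetsType mu)) => x.
  (* The translation that moves the value [x] of the coordinate to [c i]. *)
  have [d dx] : exists d : Omega, d i = cxor (c i) x by exact: exists_coord.
  apply: ae_imply2 (ae_shift hmu (only i d) Fc) (sd d b) => w Fw sdw wx.
  move: Fw sdw; rewrite {1}/shift {1}/only eqxx dx wx cxorC (cxorC (c i)) cxorK.
  rewrite shiftA (shiftC (away i b)) -shiftA.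
  by move=> /(_ erefl) ->; do 3 (case: (_ \in A)).
by move=> aex; apply: ae_imply aex => w /(_ _ erefl).
Qed.

(** [B] collects the values of the coordinate [i] whose cylinder lies almost
    everywhere in [A]; by the zero-one law [A] is null in each of the others. *)
Lemma off_invariant_coord i : (forall b, ae_invariant (away i b)) ->
  exists B : set (cube i.+1), {ae mu, forall w, A w <-> B (w i)}.
Proof.
move=> inv; exists [set x | {ae mu, forall w, w i = x -> A w}].
have : {ae mu, forall w (x : cube i.+1), w i = x ->
    (A w <-> {ae mu, forall v, v i = x -> A v})}.
  apply: (filter_forall (ae_filter_ringOfSetsType mu)) => x.
  have [c <-] := exists_coord x.
  have inv' b : {ae mu, forall w, A w -> A (shift (away i b) w)}.
    by apply: ae_imply (inv b) => w E /mem_set; rewrite -E inE.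
  have [Ac|Ac] := zero_one_off hmu c mA inv'.
  - by apply: ae_imply (Ac) => w Aw wi; split => // _; exact: Aw.
  apply: ae_imply (Ac) => w nAw wi; split; first by move/nAw => /(_ wi).
  move=> Ac'.
  have : {ae mu, forall v, v i <> c i}.
    by apply: ae_imply2 Ac Ac' => v nAv Av vi; exact: nAv (Av vi).
  by move=> /(ae_meets_cylinder hmu i.+1 c)[v vi /(_ i (ltnSn i))].
by move=> aex; apply: ae_imply aex => w /(_ _ erefl).
Qed.

Lemma depends_on_coord : exists i (B : set (cube i.+1)),
  {ae mu, forall w, A w <-> B (w i)}.
Proof.
have [[i invi]|/forallNP ninv] :=
  pselect (exists i, forall b, ae_invariant (away i b)).
  by exists i; exact: off_invariant_coord.
(* Invariance under every translation: any coordinate will do. *)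
exists 0%N; apply: off_invariant_coord => b; apply: invariant_all => i a.
by have [|/ninv//] := dichotomy i; exact.
Qed.

End indicator.

(** * Uniqueness of the coordinate *)

Section coordinates.
Variables (R : realType) (mu : probability Omega R).
Hypothesis hmu : is_product_measure mu.

Lemma ae_coord_inj (U : Type) k (g g' : cube k.+1 -> U) :
  {ae mu, forall w, g (w k) = g' (w k)} -> g = g'.
Proof.
move=> gg'; apply/funext => x; have [c <-] := exists_coord x.
by have [w + /(_ k (ltnSn k)) <-] := ae_meets_cylinder hmu k.+1 c gg'.
Qed.

(** Any pair of values of two distinct coordinates is attained at a point
    where the two functions agree. *)
Lemma ae_coord_neq (U : Type) k l (g : cube k.+1 -> U) (g' : cube l.+1 -> U) :
  k <> l -> {ae mu, forall w, g (w k) = g' (w l)} -> forall x y, g x = g' y.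
Proof.
move=> /eqP kl gg' x y.
have [a <-] := exists_coord x; have [b <-] := exists_coord y.
have [w] := ae_meets_cylinder hmu (maxn k l).+1
  (shift (only k a) (away k b)) gg'.
move=> + wc; rewrite !wc ?ltnS ?leq_maxl ?leq_maxr //.
by rewrite /shift /only /away eqxx eq_sym (negPf kl) cxor0l cxorC cxor0l.
Qed.

Lemma eq_mod_null0P (A : set Omega) :
  eq_mod_null mu A set0 <-> {ae mu, forall w, A w = False}.
Proof.
rewrite /eq_mod_null setD0 set0D setU0.
rewrite /prop_near1 /= /nbhs /= /almost_everywhere.
rewrite (_ : ~` _ = A) //; apply/seteqP; split => w /=.
  by move=> nA; apply: contrapT => Aw; apply: nA; exact/propext.
by move=> Aw E; rewrite -E.
Qed.

Lemma eq_mod_nullTP (A : set Omega) :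
  eq_mod_null mu A setT <-> {ae mu, forall w, A w = True}.
Proof.
rewrite /eq_mod_null setDT set0U setTD.
rewrite /prop_near1 /= /nbhs /= /almost_everywhere.
rewrite (_ : [set x | A x = True] = A) //; apply/seteqP; split => w /=.
  by move=> E; have : True by []; rewrite -E.
by move=> Aw; exact/propext.
Qed.

Lemma indic_coordP (A : set Omega) k (B : set (cube k.+1)) :
  (\1_A : Omega -> R) = J (\1_B) %[ae mu] <-> {ae mu, forall w, A w = B (w k)}.
Proof.
split=> aeq; apply: ae_imply aeq => w; last first.
  move=> AB _; rewrite /J /coord !indicE (_ : (w \in A) = (w k \in B)) //.
  by apply/idP/idP; rewrite !inE AB.
move=> /(_ I); rewrite /J /coord !indicE => /eqP; rewrite eqr_nat => /eqP E.
apply/propext; split=> /mem_set Aw; apply: set_mem; move: E; rewrite Aw;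
by case: (_ \in _).
Qed.

Lemma is_coord_indicator_unique (A : set Omega) k l
    (B : set (cube k.+1)) (C : set (cube l.+1)) :
  is_coord_indicator mu A B -> is_coord_indicator mu A C ->
  existT (fun k => set (cube k.+1)) k B = existT _ l C.
Proof.
move=> [/set0P[x Bx] _ /indic_coordP AB] [_ CT /indic_coordP AC].
have BC : {ae mu, forall w, B (w k) = C (w l)}.
  by apply: ae_imply2 AB AC => w <-.
have [kl|kl] := pselect (k = l); first by subst l; rewrite (ae_coord_inj BC).
case/eqP: CT; apply/seteqP; split=> // y _.
by rewrite -(ae_coord_neq kl BC x y).
Qed.

End coordinates.

Theorem theorem2p1 (R : realType) (p : R) (hp : 1 < p)
    (mu : probability Omega R) (hmu : is_product_measure mu)
    (A : set Omega) (mA : measurable A)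
    (hA : Xhat mu p (\1_A)) :
  exactly_one3
    (eq_mod_null mu A set0)
    (eq_mod_null mu A setT)
    (exists! kB : {k : nat & set (cube k.+1)},
       is_coord_indicator mu A (projT2 kB))
  /\ (~ eq_mod_null mu A set0 -> ~ eq_mod_null mu A setT ->
      exists! k : nat, depends_only_on_coord mu (\1_A) k).
Proof.
have [i [B AB']] := depends_on_coord hmu mA (Xhat_approximable hp hA).
have AB : {ae mu, forall w, A w = B (w i)}.
  by apply: ae_imply AB' => w /propext.
have constB (P : Prop) : {ae mu, forall w, A w = P} -> B = fun=> P.
  by move=> AP; apply: (ae_coord_inj hmu); apply: ae_imply2 AB AP => w <-.
have null_B0 : eq_mod_null mu A set0 <-> B = set0.
  rewrite eq_mod_null0P; split=> [/constB//|B0].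
  by apply: ae_imply AB => w ->; rewrite B0.
have full_BT : eq_mod_null mu A setT <-> B = setT.
  rewrite eq_mod_nullTP; split=> [/constB//|BT].
  by apply: ae_imply AB => w ->; rewrite BT.
have indic_B : (\1_A : Omega -> R) = J (\1_B) %[ae mu] by exact/indic_coordP.
split.
  have nontrivial (kB : {k : nat & set (cube k.+1)}) :
      is_coord_indicator mu A (projT2 kB) -> B <> set0 /\ B <> setT.
    case: kB => k C [/= /eqP C0 /eqP CT /indic_coordP AC]; split=> BE.
      apply: C0; apply: (ae_coord_inj hmu).
      by apply: ae_imply2 AB AC => w -> <-; rewrite BE.
    apply: CT; apply: (ae_coord_inj hmu).
    by apply: ae_imply2 AB AC => w -> <-; rewrite BE.
  rewrite /exactly_one3 (propext null_B0) (propext full_BT).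
  have [B0|B0] := pselect (B = set0).
    apply: Or31; split => //.
      by rewrite B0 => /seteqP[_ /(_ point I)].
    by case=> kB [/nontrivial[]].
  have [BT|BT] := pselect (B = setT).
    by apply: Or32; split => //; case=> kB [/nontrivial[]].
  apply: Or33; split => //; exists (existT _ i B).
  have iB : is_coord_indicator mu A B by split=> //; exact/eqP.
  by split=> // -[k C] kC; exact: (is_coord_indicator_unique hmu iB kC).
rewrite (propext null_B0) (propext full_BT) => B0 BT.
exists i; split; first by exists \1_B.
move=> k [g Ag]; apply: contrapT => ik; apply: BT; apply/seteqP; split=> // y _.
have /eqP/set0P[x Bx] := B0.
have Bg : {ae mu, forall w, (\1_B : _ -> R) (w i) = g (w k)}.
  by apply: ae_imply2 indic_B Ag => w /(_ I) AJ /(_ I); apply: etrans (esym AJ).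
have := ae_coord_neq hmu ik Bg.
move=> H; have := H x point; rewrite -(H y point) !indicE mem_set // => /eqP.
by rewrite eqr_nat; case: (boolP (y \in B)) => // /set_mem.
Qed.
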